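(* Let $(X,\|\cdot\|)$ be a normed vector space over $\mathbb{R}$ of finite dimension, and let $A\subseteq X$ be an arbitrary subset. With each point $a\in A$ associate a set $S(a)\subseteq X$ containing $a$ in its interior, such that the diameters $\Delta(S(a))$, $a\in A$, have a finite upper bound. Assume that for some $\tau>1$ there is an upper bound $\kappa\in\mathbb{N}$ to the cardinality $n$ of any ordered set $\{a_i:1\le i\le n\}\subseteq A$ with respect to which the ordered set $\{S(a_i):1\le i\le n\}$ is in $\tau$-satellite configuration. Then for some $m\le\kappa$ there are pairwise disjoint subsets $A_1,\ldots,A_m$ of $A$ such that $$A\subseteq\bigcup_{j=1}^{m}\bigcup_{a\in A_j}\operatorname{int}(S(a))$$ and for each $j$, $1\le j\le m$, the elements of the collection $\{S(a):a\in A_j\}$ are pairwise disjoint.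
   Context: $\Delta(S)$ denotes the diameter of a set $S$ and $\operatorname{int}(S)$ its interior. $\mathbb{N}=\{1,2,3,\ldots\}$. $\tau$-satellite configuration: fix $\tau>1$. Let $\{S_i:1\le i\le n\}$ be an ordered collection of subsets of $X$ with each $S_i$ having finite diameter and containing a point $a_i$ in its interior. The ordered collection of sets $S_i$ is in $\tau$-satellite configuration with respect to the ordered set of points $a_i$ if (i) for all $i\le n$, $S_i\cap S_n\ne\varnothing$, and (ii) for all pairs $i<j\le n$, $a_j\notin\operatorname{int}(S_i)$ and $\Delta(S_j)<\tau\cdot\Delta(S_i)$. *)

(* Defs.v *)
From mathcomp Require Import all_boot all_order all_algebra.
From mathcomp Require Import all_classical all_reals all_analysis.
Import numFieldNormedType.Exports.
Set Implicit Arguments.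
Unset Strict Implicit.
Unset Printing Implicit Defensive.
Import Order.TTheory GRing.Theory Num.Theory.
Local Open Scope classical_set_scope.
Local Open Scope ring_scope.

(* [Vector.axiom n X] is the type of linear bijections from X onto 'rV_n. *)
Definition finite_dimensional (R : realType) (X : normedModType R) : Prop :=
  exists n : nat, inhabited (Vector.axiom n X).

(* As an extended real, so that unbounded sets have diameter +oo. *)
Definition diameter (R : realType) (X : normedModType R) (S : set X) : \bar R :=
  ereal_sup [set (`|p.1 - p.2|)%:E | p in S `*` S].

(* Indices are shifted: 1, ..., n.+1 becomes 0, ..., n, and the last set is
   S ord_max.  The points a are pairwise distinct as soon as the configuration
   holds, since a j is in the interior of S j but not in that of S i for i < j;
   likewise for the sets. *)
Definition satellite_configuration (R : realType) (X : normedModType R)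
    (tau : R) (n : nat) (S : 'I_n.+1 -> set X) (a : 'I_n.+1 -> X) : Prop :=
  [/\ forall i, (diameter (S i) < +oo)%E,
      forall i, interior (S i) (a i),
      forall i, S i `&` S ord_max !=set0
    & forall i j : 'I_n.+1, (i < j)%N ->
        ~ interior (S i) (a j) /\
        (diameter (S j) < tau%:E * diameter (S i))%E].

(* Main.v *)
(* Let M bound the diameters, and let the level of a in A be some k such that
   M / tau^k lies in [d, tau d), where d is the diameter of S a.  Well-order X by
   increasing level first: then b after a forces diam (S b) < tau * diam (S a).
   By recursion along this order, discard a when it lies in the interior of S b
   for some earlier kept b; otherwise keep it, with a colour that no earlier
   kept b with S b meeting S a has.  If all kappa colours were taken,
   earlier witnesses of each colour, followed by a, would form a satellite
   configuration of kappa + 1 points.  The colour classes are the sets A_j. *)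
Require Import Defs.
From mathcomp Require Import all_boot all_order all_algebra.
From mathcomp Require Import all_classical all_reals all_analysis.
From mathcomp Require Import wochoice.
Import numFieldNormedType.Exports.
Set Implicit Arguments.
Unset Strict Implicit.
Unset Printing Implicit Defensive.
Import Order.TTheory GRing.Theory Num.Theory.
Local Open Scope classical_set_scope.
Local Open Scope ring_scope.

Lemma well_order_total (T : eqType) (r : rel T) : well_order r -> total r.
Proof. by move=> /withinW wo x y; apply: (@wo_chainW T r predT (wo _)). Qed.

Lemma well_order_anti (T : eqType) (r : rel T) :
  well_order r -> antisymmetric r.
Proof.
by move=> /withinW wo x y; apply: (@wo_chain_antisymmetric T r predT (wo _)).
Qed.

(** The least of [x], [y], [z] decides: if it is not [x], antisymmetry identifies two neighbours of
    the chain. *)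
Lemma well_order_trans (T : eqType) (r : rel T) : well_order r -> transitive r.
Proof.
move=> wo y x z xy yz.
have [|m [[]]] := wo [mem [:: x; y; z]]; first by exists x; rewrite !inE eqxx.
rewrite !inE => mE lbm _.
have [mx my] : r m x /\ r m y by split; apply: lbm; rewrite !inE eqxx ?orbT.
case/or3P: mE lbm => /eqP mE lbm; subst m.
- by apply: lbm; rewrite !inE eqxx !orbT.
- by rewrite (well_order_anti wo (introT andP (conj xy mx))).
- by rewrite -(well_order_anti wo (introT andP (conj yz my))).
Qed.

(** A least non-accessible element would have only accessible predecessors. *)
Lemma well_order_wf (T : eqType) (r : rel T) :
  well_order r -> well_founded (fun x y => (x != y) && r x y).
Proof.
move=> wo; apply: contrapT => /existsNP[x xNacc].
pose N : {pred T} := fun x => `[< ~ Acc (fun x y => (x != y) && r x y) x >].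
have [|m [[/asboolP mNacc lbm] _]] := wo N; first by exists x; apply/asboolP.
apply: mNacc; constructor=> y /andP[yNm ym]; apply: contrapT => yNacc.
have my : r m y by apply: lbm; apply/asboolP.
by move: yNm; rewrite (well_order_anti wo (introT andP (conj ym my))) eqxx.
Qed.

(** Lexicographic order: [k] first, ties broken by an arbitrary well-order. The least element of a
    set is found in its fibre of smallest [k]. *)
Lemma well_order_refining (T : eqType) (k : T -> nat) :
  exists r : rel T, well_order r /\ forall x y, r x y -> (k x <= k y)%N.
Proof.
have [r wo] := well_ordering_principle T.
exists (fun x y => (k x < k y)%N || (k x == k y) && r x y); split; last first.
  by move=> x y /orP[/ltnW //|/andP[/eqP-> _]].
apply: antisymmetric_well_order => [x y|P [x0 Px0]].
  case: (ltngtP (k x) (k y)) => //= _; exact: well_order_anti.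
have exk : exists n, `[< exists x, x \in P /\ k x = n >].
  by exists (k x0); apply/asboolP; exists x0.
case: (ex_minnP exk) => n /asboolP[x1 [Px1 kx1]] n_min.
have [|m [[/andP[Pm /eqP km] lbm] _]] := wo [pred x | (x \in P) && (k x == n)].
  by exists x1; rewrite inE Px1 kx1 eqxx.
exists m; split=> // x Px; rewrite km.
have : (n <= k x)%N by apply: n_min; apply/asboolP; exists x.
rewrite leq_eqVlt => /orP[/eqP nE|->//].
by rewrite -nE eqxx lbm ?orbT // inE Px nE eqxx.
Qed.

Lemma greedy_coloring (T : Type) (V : finType) (lt : T -> T -> Prop)
    (covers meets : T -> T -> Prop) : well_founded lt ->
  (* [None] stands for discarded elements, and also for those at which no colour
     is available. *)
  exists g : T -> option V, forall a,
    (forall c, g a = Some c -> forall b, lt b a ->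
       (g b -> ~ covers b a) /\ (g b = Some c -> ~ meets b a)) /\
    (g a = None -> ~ (exists b, [/\ lt b a, g b & covers b a]) ->
       forall c, exists b, [/\ lt b a, g b = Some c & meets b a]).
Proof.
move=> wf.
pose F a (h : forall b, lt b a -> option V) : option V :=
  if pselect (exists b (p : lt b a), h b p /\ covers b a) then None
  else [pick c | `[< ~ exists b (p : lt b a), h b p = Some c /\ meets b a >]].
(* The recursion unfolds because [F] uses [h] only through its values; this is where extensionality
   enters. *)
have FE a : Fix wf (fun=> option V) F a = F a (fun b _ => Fix wf _ F b).
  apply: Fix_eq => x f h fh; congr F.
  by apply: functional_extensionality_dep => y; apply/funext => p.
exists (Fix wf (fun=> option V) F) => a; rewrite FE /F.
case: pselect => [cov|ncov].
  split=> // _ []; have [b [p [gb ba]]] := cov; by exists b.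
case: pickP => [c /asboolP Nused|used]; split=> //.
  move=> _ [<-] b ba; split=> [gb bca|gb bma]; last by apply: Nused; exists b, ba.
  by apply: ncov; exists b, ba.
move=> _ _ c; have /asboolPn/contrapT[b [p [gb ba]]] := negbT (used c).
by exists b.
Qed.

(** Take the least [k] satisfying the upper bound, which exists since [M / tau ^+ k] tends to 0. The
    lower bound is [d <= M] if [k] is 0, and otherwise the failure of the upper bound at the
    preceding exponent. *)
Lemma exists_geometric_level (R : realType) (tau M d : R) :
  1 < tau -> 0 < d <= M -> exists k : nat, d <= M / tau ^+ k < tau * d.
Proof.
move=> tau1 /andP[d0 dM]; have tau0 : 0 < tau by apply: lt_trans tau1.
have exk : exists k : nat, M / tau ^+ k < tau * d.
  have /(cvgr_lt 0)/(_ (tau * d)) : geometric M tau^-1 @ \oo --> 0.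
    apply: cvg_geometric.
    by rewrite ger0_norm ?invr_ge0 1?ltW// invf_lt1.
  move=> /(_ (mulr_gt0 tau0 d0))/filter_ex[k /=].
  by rewrite exprVn; exists k.
case: (ex_minnP exk) => -[|k] kP k_min; [exists 0%N|exists k.+1].
  by rewrite kP expr0 divr1 dM.
rewrite kP andbT leNgt exprS invfM mulrCA ltr_pdivrMl//.
by apply/negP => /k_min; rewrite ltnn.
Qed.

Lemma dist_le_diameter (R : realType) (X : normedModType R) (S : set X) x y :
  S x -> S y -> (`|x - y|%:E <= diameter S)%E.
Proof. by move=> Sx Sy; apply: ereal_sup_ubound; exists (x, y). Qed.

(** The points [x], [y] need not lie in [S]: they only supply a nonzero direction in which to move
    from [a] inside a ball contained in [S]. *)
Lemma diameter_gt0 (R : realType) (X : normedModType R) (S : set X) a (x y : X) :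
  interior S a -> x <> y -> (0 < diameter S)%E.
Proof.
move=> /nbhs_ballP[e /= e0 eS] xy.
have v0 : 0 < `|x - y| by rewrite normr_gt0 subr_eq0; apply/eqP.
pose w := (e / 2 / `|x - y|) *: (x - y).
have we : `|w| = e / 2.
  by rewrite normrZ ger0_norm ?divfK ?gt_eqF// !divr_ge0// ltW.
have e20 : 0 < e / 2 by rewrite divr_gt0.
apply: (@lt_le_trans _ _ `|a + w - a|%:E).
  by rewrite addrAC subrr add0r lte_fin we.
apply: dist_le_diameter; apply: eS; last exact: ballxx.
by rewrite -ball_normE /= opprD addNKr normrN we ltr_pdivrMr// ltr_pMr// ltr1n.
Qed.

Lemma exists_diameter_level (R : realType) (X : normedModType R) (tau M : R)
    (A : set X) (S : X -> set X) : 1 < tau ->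
    (forall a, A a -> interior (S a) a) ->
    (forall a, A a -> (diameter (S a) <= M%:E)%E) ->
  (* [a <> b] rules out the zero space, where all diameters vanish. *)
  exists k : X -> nat, forall a b, A a -> A b -> a <> b -> (k a <= k b)%N ->
    (diameter (S b) < tau%:E * diameter (S a))%E.
Proof.
move=> tau1 hS hM; have tau0 : 0 < tau by apply: lt_trans tau1.
pose level (a : X) (k : nat) :=
  ((diameter (S a) <= (M / tau ^+ k)%:E) /\
   ((M / tau ^+ k)%:E < tau%:E * diameter (S a)))%E.
have levelE a : A a -> (0 < diameter (S a))%E -> level a (get (level a)).
  move=> Aa da; apply: (@getPex _ (level a)); move: da (hM a Aa); rewrite /level.
  case: (diameter (S a)) => // d; rewrite lee_fin lte_fin => d0 dM.
  have [k /andP[dk kd]] : exists k, d <= M / tau ^+ k < tau * d.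
    by apply: exists_geometric_level => //; rewrite d0.
  by exists k; rewrite -EFinM lee_fin lte_fin.
exists (fun a => get (level a)) => a b Aa Ab ab kab.
have ak : level a (get (level a)).
  by apply: levelE => //; exact: diameter_gt0 (hS a Aa) ab.
have bk : level b (get (level b)).
  by apply: levelE => //; exact: diameter_gt0 (hS b Ab) ab.
have M0 : 0 <= M.
  rewrite -lee_fin (le_trans _ (hM a Aa))// ltW//.
  exact: diameter_gt0 (hS a Aa) ab.
(* Between the two level bounds there remains [M / tau ^+ k b <= M / tau ^+ k a], which uses
   [0 <= M]. *)
apply: (le_lt_trans bk.1); apply: le_lt_trans ak.2.
rewrite lee_fin ler_wpM2l// lef_pV2 ?posrE ?exprn_gt0//.
by rewrite ler_eXn2l.
Qed.

Theorem theorem2 (R : realType) (X : normedModType R)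
    (hX : finite_dimensional X)
    (A : set X) (S : X -> set X)
    (hS : forall a, A a -> interior (S a) a)
    (hdiam : exists M : R, forall a, A a -> (diameter (S a) <= M%:E)%E)
    (tau : R) (htau : 1 < tau)
    (kappa : nat) (hkappa : (0 < kappa)%N)
    (hsat : forall (n : nat) (a : 'I_n.+1 -> X),
        (forall i, A (a i)) ->
        satellite_configuration tau (fun i => S (a i)) a ->
        (n.+1 <= kappa)%N) :
  exists2 m : nat, (0 < m <= kappa)%N &
  exists B : 'I_m -> set X,
    [/\ forall j, B j `<=` A,
        trivIset setT B,
        A `<=` \bigcup_(j in setT) \bigcup_(a in B j) interior (S a)
      & forall j, trivIset (B j) S].
Proof.
have [M hM] := hdiam.
have [k hk] := exists_diameter_level htau hS hM.
have [r [wo rk]] := well_order_refining k.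
pose lt x y := (x != y) && r x y.
(* The colouring runs over all of [X]; with [A b] in both relations, points outside [A] block
   nothing. *)
pose covers b a := A b /\ interior (S b) a.
pose meets b a := A b /\ S b `&` S a !=set0.
have [g gP] := @greedy_coloring X 'I_kappa lt covers meets (well_order_wf wo).
pose B j := [set a | A a /\ g a = Some j].
have B_uncovered i j a b : B i a -> B j b -> lt b a -> ~ interior (S b) a.
  move=> [Aa ga] [Ab gb] ba Sba.
  by have [+ _] := (gP a).1 i ga b ba; rewrite gb; apply.
have B_disj j a b : B j a -> B j b -> lt b a -> ~ (S b `&` S a !=set0).
  move=> [Aa ga] [Ab gb] ba Sba.
  by have [_ +] := (gP a).1 j ga b ba; rewrite gb => /(_ erefl); apply.
exists kappa; first by rewrite hkappa leqnn.
exists B; split.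
- by move=> j a [].
- by move=> i j _ _ [a [[_ gi] [_]]]; rewrite gi => -[].
- move=> a Aa; case ga : (g a) => [j|].
    by exists j => //; exists a; [split|exact: hS].
  have [[b [ba gb [Ab Sba]]]|ncov] :=
      pselect (exists b, [/\ lt b a, g b & covers b a]).
    by case gbE : (g b) gb => [j|//] _; exists j => //; exists b.
  (* Here [a] is uncovered yet uncoloured, so each colour [c] is blocked by an earlier point
     [b c]. *)
  have /choice[b bP] := (gP a).2 ga ncov.
  have b_inj : injective b.
    by move=> c c' bb; have [_ + _] := bP c; rewrite bb; have [_ -> _ []] := bP c'.
  (* The satellite condition depends on the order of the points, so the witnesses are listed along
     [r]; all of them precede [a]. *)
  pose s := sort r (map b (enum 'I_kappa)).
  have size_s : size s = kappa by rewrite size_sort size_map size_enum_ord.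
  have s_uniq : uniq s by rewrite sort_uniq map_inj_uniq// enum_uniq.
  have s_lt : pairwise r s.
    rewrite -sorted_pairwise; last exact: well_order_trans.
    exact/sort_sorted/well_order_total.
  have sP i : (i < kappa)%N -> exists c, nth a s i = b c.
    move=> ik; have : nth a s i \in s by rewrite mem_nth// size_s.
    by rewrite mem_sort => /mapP[c _ ->]; exists c.
  (* With default value [a], [nth a s] enumerates [rcons s a] on 'I_kappa.+1. *)
  have s_last : nth a s kappa = a by rewrite nth_default// size_s.
  have As (i : 'I_kappa.+1) : A (nth a s i).
    have [ik|ik] := ltnP i kappa; last by rewrite nth_default// size_s.
    by have [c ->] := sP i ik; have [_ _ []] := bP c.
  have s_ltE (i j : 'I_kappa.+1) : (i < j)%N -> lt (nth a s i) (nth a s j).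
    move=> ij; have ik : (i < kappa)%N by rewrite (leq_trans ij)// -ltnS.
    have [jk|jk] := ltnP j kappa; last first.
      rewrite [X in lt _ X]nth_default ?size_s//.
      by have [c ->] := sP i ik; have [] := bP c.
    rewrite /lt nth_uniq ?size_s// ltn_eqF//=.
    by move/pairwiseP : s_lt; apply; rewrite ?inE ?size_s.
  suff /(hsat kappa _ As) : satellite_configuration tau
      (fun i : 'I_kappa.+1 => S (nth a s i)) (fun i => nth a s i).
    by rewrite ltnn.
  split=> [i|i|i|i j ij].
  + exact: le_lt_trans (hM _ (As i)) (ltry _).
  + exact: hS.
  + rewrite [X in _ `&` S X]s_last.
    have [ik|ik] := ltnP i kappa.
      by have [c ->] := sP i ik; have [_ _ []] := bP c.
    rewrite nth_default ?size_s// setIid; exists a.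
    exact: interior_subset (hS a Aa).
  + have /andP[sij rij] := s_ltE i j ij.
    split; last by apply: hk => //; [exact/eqP|exact: rk].
    have ik : (i < kappa)%N by rewrite (leq_trans ij)// -ltnS.
    have [c ci] := sP i ik; have [ca gc _] := bP c.
    have Bi : B c (nth a s i) by rewrite ci; split => //; have [_ _ []] := bP c.
    (* A later witness is uncovered because it was kept, the final point [a] because of [ncov]. *)
    have [jk|jk] := ltnP j kappa.
      have [c' cj] := sP j jk; have [_ gc' [Ac' _]] := bP c'.
      have Bj : B c' (nth a s j) by rewrite cj; split.
      by apply: (B_uncovered _ _ _ _ Bj Bi); apply/andP.
    rewrite [X in ~ _ X]nth_default ?size_s// ci => Sca; apply: ncov.
    by exists (b c); rewrite gc; split=> //; split=> //; have [_ _ []] := bP c.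
- move=> j a b Ba Bb Sab; apply: contrapT => /eqP ab.
  have [rab|rba] := orP (well_order_total wo a b).
    by apply: (B_disj j b a) => //; apply/andP.
  apply: (B_disj j a b) => //; last by rewrite setIC.
  by rewrite /lt eq_sym ab.
Qed.
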